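(* For every group $G$, the group $G$ endowed with its submaximal paratopological group topology $\mathcal{PM}_G$ is a topological group.
   Context: A paratopological group topology on a group $G$ is a topology for which multiplication is jointly continuous (no separation axiom is assumed). Let $\mathcal{PL}(G)$ be the poset, ordered by inclusion, of all paratopological group topologies on $G$, and $\delta_G$ the discrete topology. A maximal paratopological group topology on $G$ is a maximal element of $\mathcal{PL}(G)\setminus\{\delta_G\}$. The submaximal paratopological group topology $\mathcal{PM}_G$ is the infimum, in $\mathcal{PL}(G)$, of all maximal paratopological group topologies on $G$ (the infimum of the empty family being $\delta_G$). *)

(* Defs.v *)
From HB Require Import structures.
From mathcomp Require Import all_boot all_order.
From mathcomp Require Import boolp classical_sets filter topology.

Set Implicit Arguments.
Unset Strict Implicit.
Unset Printing Implicit Defensive.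

Import Order.TTheory.

Local Open Scope classical_set_scope.

HB.structure Definition PreTopologicalGroup := {G of Topological G & Group G}.

Definition paratopological_group (G : PreTopologicalGroup.type) : Prop :=
  continuous (fun z : G * G => (z.1 * z.2)%g : G).

Definition topological_group (G : PreTopologicalGroup.type) : Prop :=
  paratopological_group G /\ continuous (fun x : G => (x^-1)%g : G).

Record topology (T : Type) := Topology {
  opens : set_system T;
  opensT : opens setT;
  opensI : setI_closed opens;
  opens_bigcup : forall F : set_system T,
    F `<=` opens -> opens (\bigcup_(U in F) U) }.

(* A copy of the group G whose canonical topology has the open sets tau. *)
Definition topologized (G : groupType) (tau : topology G) : Type := G.

Section Topologized.
Variables (G : groupType) (tau : topology G).

HB.instance Definition _ := Group.copy (topologized tau) G.

Lemma opens_bigcupT (I : Type) (f : I -> set G) :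
  (forall i, opens tau (f i)) -> opens tau (\bigcup_i f i).
Proof.
move=> tf.
have -> : \bigcup_i f i = \bigcup_(U in range f) U.
  by rewrite bigcup_image.
by apply: opens_bigcup => _ [i _ <-].
Qed.

HB.instance Definition _ := isOpenTopological.Build (topologized tau)
  (opensT tau) (@opensI _ tau) opens_bigcupT.

Lemma open_topologizedE (U : set G) : @open (topologized tau) U = opens tau U.
Proof. by []. Qed.

End Topologized.

Record paratopology (G : groupType) := Paratopology {
  topology_of_paratopology :> topology G;
  paratopologyP : paratopological_group (topologized topology_of_paratopology) }.

Section Paratopology.
Variable G : groupType.
Implicit Types sigma tau : paratopology G.

Lemma paratopology_inj sigma tau :
  opens sigma = opens tau -> sigma = tau.
Proof.
case: sigma tau => [[s s1 s2 s3] sP] [[t t1 t2 t3] tP] /= st.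
subst t; have e1 := Prop_irrelevance s1 t1.
have e2 := Prop_irrelevance s2 t2; have e3 := Prop_irrelevance s3 t3.
subst t1 t2 t3; by rewrite (Prop_irrelevance sP tP).
Qed.

HB.instance Definition _ := gen_eqMixin (paratopology G).
HB.instance Definition _ := gen_choiceMixin (paratopology G).

Definition paratopology_le sigma tau : bool :=
  `[< opens sigma `<=` opens tau >].

Lemma paratopology_le_refl : reflexive paratopology_le.
Proof. by move=> tau; apply/asboolP. Qed.

Lemma paratopology_le_anti : antisymmetric paratopology_le.
Proof.
move=> sigma tau /andP[/asboolP st /asboolP ts].
by apply: paratopology_inj; apply/seteqP.
Qed.

Lemma paratopology_le_trans : transitive paratopology_le.
Proof.
move=> t s u /asboolP st /asboolP tu; apply/asboolP.
exact: subset_trans st tu.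
Qed.

HB.instance Definition _ := Order.Le_isPOrder.Build (Order.Disp tt tt)
  (paratopology G) paratopology_le_refl paratopology_le_anti
  paratopology_le_trans.

Lemma le_paratopologyP sigma tau :
  reflect (opens sigma `<=` opens tau) (sigma <= tau)%O.
Proof. exact: asboolP. Qed.

Definition discrete_opens : topology G :=
  @Topology G setT Logic.I (fun _ _ _ _ => Logic.I) (fun _ _ => Logic.I).

Lemma discrete_opensP : paratopological_group (topologized discrete_opens).
Proof.
move=> [x y] U /=; rewrite nbhsE => -[V [_ Vxy] VU].
exists ([set x], [set y]) => /=.
  by split; rewrite nbhsE; [exists [set x]|exists [set y]].
by move=> [a b] /= [-> ->]; apply: VU.
Qed.

Definition discrete_paratopology := Paratopology discrete_opensP.

(* The maximal elements of the poset without its top element. *)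
Definition maximal_paratopology : set (paratopology G) :=
  [set tau | tau <> discrete_paratopology /\
     forall sigma, sigma <> discrete_paratopology ->
       (tau <= sigma)%O -> sigma = tau].

(* [infimum] returns its first argument on the empty family. On other families
   the default is not used, by [infimums_paratopology] below. *)
Definition submaximal_paratopology : paratopology G :=
  infimum discrete_paratopology maximal_paratopology.

Lemma le_discrete tau : (tau <= discrete_paratopology)%O.
Proof. exact/le_paratopologyP. Qed.

Section Infimums.
Variable A : set (paratopology G).

(* The infimum is the join of the lower bounds: the coarsest topology finer
   than all of them, whose multiplication is again continuous. *)
Definition finer_than_lbound : set (topology G) :=
  [set t | forall sigma, lbound A sigma -> opens sigma `<=` opens t].

Definition inf_opens_set : set_system G :=
  [set U | forall t, finer_than_lbound t -> opens t U].

Fact inf_opensT : inf_opens_set setT.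
Proof. by move=> t _; exact: opensT. Qed.

Fact inf_opensI : setI_closed inf_opens_set.
Proof. by move=> U V iU iV t tA; apply: opensI; [exact: iU|exact: iV]. Qed.

Fact inf_opens_bigcup (F : set_system G) :
  F `<=` inf_opens_set -> inf_opens_set (\bigcup_(U in F) U).
Proof. by move=> FI t tA; apply: opens_bigcup => U /FI; apply. Qed.

Definition inf_opens := Topology inf_opensT inf_opensI inf_opens_bigcup.

Let X : topologicalType := topologized inf_opens.

Definition mul_open_set : set_system G :=
  [set U | @open (X * X)%type [set z | U ((z.1 : G) * (z.2 : G))%g]].

Fact mul_openT : mul_open_set setT. Proof. exact: openT. Qed.

Fact mul_openI : setI_closed mul_open_set.
Proof. by move=> U V oU oV; exact: openI. Qed.

Fact mul_open_bigcup (F : set_system G) :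
  F `<=` mul_open_set -> mul_open_set (\bigcup_(U in F) U).
Proof.
move=> FI; rewrite /mul_open_set /=.
have -> : [set z : X * X | (\bigcup_(U in F) U) ((z.1 : G) * (z.2 : G))%g] =
    \bigcup_(U in F) [set z : X * X | U ((z.1 : G) * (z.2 : G))%g].
  by apply/seteqP; split=> z [U FU Uz]; exists U.
by apply: bigcup_open => U /FI.
Qed.

Definition mul_open := Topology mul_openT mul_openI mul_open_bigcup.

Lemma mul_open_finer : finer_than_lbound mul_open.
Proof.
move=> sigma sA U sU /=; rewrite /mul_open_set /= openE => -[x y] /= Uxy.
have sX (V : set G) : opens sigma V -> @open X V.
  move=> sV; have oV : opens inf_opens V by move=> t /(_ _ sA); apply.
  exact: oV.
have nU : nbhs ((x : topologized sigma) * (y : topologized sigma))%g U.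
  by rewrite nbhsE; exists U => //; split.
have [[V W] /= [nV nW] VW] :=
  @paratopologyP _ sigma (x : topologized sigma, y : topologized sigma) U nU.
move: nV nW; rewrite !nbhsE => -[V' [oV' V'x] V'V] [W' [oW' W'y] W'W].
exists (V', W') => /=.
  split; rewrite nbhsE.
    by exists V' => //; split => //; exact: sX.
  by exists W' => //; split => //; exact: sX.
by move=> [a b] /= [/V'V Va /W'W Wb]; exact: (VW (a, b)).
Qed.

Lemma inf_opensP : paratopological_group (topologized inf_opens).
Proof.
move=> z U /=; rewrite nbhsE => -[V [oV Vz] VU].
have oV' : @open (X * X)%type [set z | V ((z.1 : G) * (z.2 : G))%g].
  exact: (oV _ mul_open_finer).
have : nbhs (z : X * X) [set z : X * X | V ((z.1 : G) * (z.2 : G))%g].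
  by rewrite nbhsE; exists [set z : X * X | V ((z.1 : G) * (z.2 : G))%g].
by apply: filterS => w /VU.
Qed.

Lemma infimums_paratopology : infimums A !=set0.
Proof.
exists (Paratopology inf_opensP); split.
  move=> tau Atau; apply/le_paratopologyP => U; apply.
  by move=> sigma /(_ _ Atau)/le_paratopologyP.
by move=> sigma sA; apply/le_paratopologyP => U sU t /(_ _ sA); apply.
Qed.

End Infimums.

Lemma submaximal_paratopologyP :
  infimums maximal_paratopology submaximal_paratopology.
Proof.
rewrite /submaximal_paratopology /infimum; case: ifPn => [/eqP ->|_].
  by split=> // tau _; exact: le_discrete.
have [tau tauP] := infimums_paratopology maximal_paratopology.
exact: xgetPex (ex_intro _ tau tauP).
Qed.

End Paratopology.

(* Main.v *)
(** Inversion is an anti-automorphism of [G], so transporting a paratopological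
    group topology along it yields another one. This is an order automorphism of
    the poset of such topologies fixing the discrete one; it therefore permutes
    the maximal topologies and preserves their infimum, which is to say that
    inversion is continuous for that infimum. *)
Require Import Defs.
From mathcomp Require Import all_boot.
From mathcomp Require Import order boolp classical_sets filter topology.

Set Implicit Arguments.
Unset Strict Implicit.
Unset Printing Implicit Defensive.

Local Open Scope classical_set_scope.

(** Frees later arguments from neighbourhood filters and the type copies [topologized tau]. *)
Lemma paratopological_group_openP (G : groupType) (tau : topology G) :
  paratopological_group (topologized tau) <->
  forall (U : set G) (x y : G), opens tau U -> U (x * y)%g ->
    exists V W : set G, [/\ opens tau V, opens tau W, V x, W y &
      forall a b, V a -> W b -> U (a * b)%g].
Proof.
split=> [ctau U x y oU Uxy|otau [x y] U /=].
  have nU : nbhs ((x : topologized tau) * (y : topologized tau))%g U.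
    by rewrite nbhsE; exists U.
  have [[V W] /= [nV nW] VW] :=
    ctau (x : topologized tau, y : topologized tau) U nU.
  move: nV nW; rewrite !nbhsE => -[V' [oV' V'x] V'V] [W' [oW' W'y] W'W].
  exists V', W'; split=> // a b /V'V Va /W'W Wb; exact: (VW (a, b)).
rewrite nbhsE => -[U' [oU' U'xy] U'U].
have [V [W [oV oW Vx Wy VW]]] := otau U' x y oU' U'xy.
exists (V, W) => /=; first by split; rewrite nbhsE; [exists V|exists W].
by move=> [a b] /= [Va Wb]; exact/U'U/VW.
Qed.

Section InverseTopology.
Variable G : groupType.
Implicit Types (U : set G) (sigma tau : paratopology G).

Definition set_inv U : set G := [set x | U (x^-1)%g].

Lemma set_invK : involutive set_inv.
Proof. by move=> U; apply/seteqP; split=> x; rewrite /set_inv /= invgK. Qed.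

(** Kept transparent, so that openness of [U] here unfolds to openness of [set_inv U] in [tau]. *)
Definition inverse_opens (tau : topology G) : topology G.
Proof.
apply: (@Topology G [set U | opens tau (set_inv U)]).
- exact: opensT.
- by move=> U V oU oV; apply: (opensI oU oV).
- move=> F FO; rewrite /= /set_inv.
  have -> : [set x | (\bigcup_(U in F) U) (x^-1)%g] =
      \bigcup_(U in set_inv @` F) U.
    by rewrite bigcup_image.
  by apply: opens_bigcup => _ [U FU <-]; exact: FO.
Defined.

Lemma inverse_opensP tau :
  paratopological_group (topologized (inverse_opens tau)).
Proof.
apply/paratopological_group_openP => U x y oU Uxy.
have otau := (paratopological_group_openP tau).1 (@paratopologyP _ tau).
have Uyx : set_inv U (y^-1 * x^-1)%g by rewrite /set_inv /= invgM !invgK.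
have [V [W [oV oW Vy Wx VW]]] := otau _ _ _ oU Uyx.
(* Inversion reverses products, so the two neighbourhoods trade places. *)
exists (set_inv W), (set_inv V); split=> //=; rewrite ?set_invK //.
by move=> a b Wa Vb; have := VW _ _ Vb Wa; rewrite /set_inv /= invgM !invgK.
Qed.

Definition inverse_paratopology tau := Paratopology (@inverse_opensP tau).

Lemma inverse_paratopologyK : involutive inverse_paratopology.
Proof.
move=> tau; apply: paratopology_inj.
by apply/seteqP; split=> U /=; rewrite set_invK.
Qed.

Lemma le_inverse_paratopology sigma tau : (sigma <= tau)%O ->
  (inverse_paratopology sigma <= inverse_paratopology tau)%O.
Proof. by move=> /le_paratopologyP st; apply/le_paratopologyP => U /st. Qed.

Lemma inverse_discrete_paratopology :
  inverse_paratopology (discrete_paratopology G) = discrete_paratopology G.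
Proof. by apply: paratopology_inj; apply/seteqP. Qed.

(** If [sigma] lies above the inverse of [tau], then the inverse of [sigma] lies above [tau], hence
    equals it by maximality. *)
Lemma maximal_inverse_paratopology tau :
  maximal_paratopology tau -> maximal_paratopology (inverse_paratopology tau).
Proof.
have inv_neq sigma : sigma <> discrete_paratopology G ->
    inverse_paratopology sigma <> discrete_paratopology G.
  move=> ns /(congr1 inverse_paratopology).
  by rewrite inverse_paratopologyK inverse_discrete_paratopology.
move=> [nd tmax]; split=> [|sigma ns]; first exact: inv_neq.
move=> /le_inverse_paratopology; rewrite inverse_paratopologyK.
by move=> /(tmax _ (inv_neq _ ns)) <-; rewrite inverse_paratopologyK.
Qed.

(** The infimum lies below the inverse of each maximal [tau], which is again maximal; inverting once
    more puts the inverse of the infimum below [tau]. *)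
Lemma inverse_submaximal_paratopology_le :
  (inverse_paratopology (submaximal_paratopology G) <=
     submaximal_paratopology G)%O.
Proof.
have [lb glb] := submaximal_paratopologyP G.
apply: glb => tau /maximal_inverse_paratopology /lb /le_inverse_paratopology.
by rewrite inverse_paratopologyK.
Qed.

End InverseTopology.

Theorem theorem4p2 (G : groupType) :
  topological_group (topologized (submaximal_paratopology G)).
Proof.
split; first exact: paratopologyP.
apply/continuousP => U oU.
(* The preimage of [U] is [set_inv U], which is open in the inverse topology because
   [set_inv (set_inv U)] is [U]. *)
have /le_paratopologyP := inverse_submaximal_paratopology_le G.
by apply; rewrite /= set_invK.
Qed.
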